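(* Let $\Gamma=(V,E)$ be a simple graph of order $n$, size $m$ and maximum degree $\Delta$. Then $$\gamma_{o}(\Gamma)\ge \left\lceil\frac{2m+n}{3\Delta+1}\right\rceil \quad\text{and}\quad \gamma_{\hat{o}}(\Gamma)\ge \left\lceil\frac{2(m+n)}{3\Delta+2}\right\rceil,$$ where $\gamma_o(\Gamma)$ and $\gamma_{\hat{o}}(\Gamma)$ are the global offensive alliance number and the global strong offensive alliance number of $\Gamma$.
   Context: Graphs are finite and simple; the order is the number of vertices and the size is the number of edges. For $S\subseteq V$ and $v\in V$, $N_S(v)$ is the set of neighbors of $v$ lying in $S$ and $N_{V\setminus S}(v)$ is the set of neighbors of $v$ lying in $V\setminus S$. A non-empty set $S\subseteq V$ (with $S=V$ allowed) is a global offensive alliance in $\Gamma$ if $|N_S(v)|\ge |N_{V\setminus S}(v)|+1$ for every $v\in V\setminus S$; it is a global strong offensive alliance if $|N_S(v)|\ge |N_{V\setminus S}(v)|+2$ for every $v\in V\setminus S$. The numbers $\gamma_o(\Gamma)$ and $\gamma_{\hat{o}}(\Gamma)$ are the minimum cardinalities of a global offensive alliance and of a global strong offensive alliance in $\Gamma$, respectively. *)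

(* Defs.v *)
From mathcomp Require Import all_boot all_order all_algebra.

Set Implicit Arguments.
Unset Strict Implicit.
Unset Printing Implicit Defensive.

(* A finite simple graph on the vertex type V is a symmetric irreflexive
   relation e on V; neither property is needed to state the definitions. *)
Section Graph.

Variables (V : finType) (e : rel V).

Definition nbrs_in (S : {set V}) (v : V) : {set V} := [set u in S | e v u].

Definition gdegree (v : V) : nat := #|nbrs_in setT v|.

Definition max_degree : nat := \max_(v : V) gdegree v.

Definition edges : {set {set V}} := [set [set p.1; p.2] | p : V * V & e p.1 p.2].

Definition gorder : nat := #|V|.

Definition gsize : nat := #|edges|.

Definition global_offensive_alliance (S : {set V}) : bool :=
  (S != set0) &&
  [forall v in ~: S, #|nbrs_in S v| >= #|nbrs_in (~: S) v| + 1].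

Definition global_strong_offensive_alliance (S : {set V}) : bool :=
  (S != set0) &&
  [forall v in ~: S, #|nbrs_in S v| >= #|nbrs_in (~: S) v| + 2].

(* The witness setT required by [arg min] is an alliance of both kinds as soon
   as V is inhabited, so these are genuine minima; if V is empty there is no
   alliance and both numbers are 0. *)
Definition goa_number : nat :=
  #|[arg min_(S < [set: V] | global_offensive_alliance S) #|S| ]|.

Definition gsoa_number : nat :=
  #|[arg min_(S < [set: V] | global_strong_offensive_alliance S) #|S| ]|.

End Graph.

(* Main.v *)
Require Import Defs.
From mathcomp Require Import all_boot all_order all_algebra.
From mathcomp Require Import zify.

(** Let S satisfy |N_S(v)| >= |N_{V\S}(v)| + k for every v outside S.  Counted
    from S, at most Delta |S| edges join S to V\S.  By the alliance condition
    deg v <= 2 |N_S(v)| - k outside S, so the degrees outside S sum to at most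
    2 Delta |S| - k (n - |S|); those inside S sum to at most Delta |S|.  The
    handshake lemma then gives 2 m + k n <= (3 Delta + k) |S|, and the two bounds
    are the cases k = 1 and k = 2. *)

Section OffensiveAlliance.

Variables (V : finType) (e : rel V).

Lemma card_nbrs_in (S : {set V}) (v : V) : #|nbrs_in e S v| = \sum_(u in S) e v u.
Proof.
by rewrite -sum1_card big_mkcond [RHS]big_mkcond; apply: eq_bigr => u _;
   rewrite inE; case: (u \in S); case: (e v u).
Qed.

Lemma gdegree_split (S : {set V}) (v : V) :
  gdegree e v = #|nbrs_in e S v| + #|nbrs_in e (~: S) v|.
Proof.
rewrite /gdegree -(cardsID S); congr (_ + _); apply: eq_card => u;
  by rewrite !inE andbC.
Qed.

Lemma gdegree_le_max (v : V) : gdegree e v <= max_degree e.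
Proof. exact: (leq_bigmax v). Qed.

Lemma sum_gdegree_card : \sum_v gdegree e v = #|[set p : V * V | e p.1 p.2]|.
Proof.
rewrite -sum1_card [RHS]big_mkcond /=.
under [RHS]eq_bigr => p _ do rewrite inE.
rewrite -(pair_bigA _ (fun x y => if e x y then 1 else 0)) /=; apply: eq_bigr => x _.
rewrite /gdegree card_nbrs_in; by apply: eq_big => y; [rewrite inE | case: (e x y)].
Qed.

Hypothesis e_sym : symmetric e.

(** The degree sum counts ordered adjacent pairs. The map [f] sends them onto the edges, and each
    fibre contains both [(x, y)] and [(y, x)], which differ since there are no loops. *)
Lemma handshake_le : irreflexive e -> 2 * gsize e <= \sum_v gdegree e v.
Proof.
move=> e_irr; rewrite sum_gdegree_card.
set D := [set p : V * V | _]; pose f (p : V * V) := [set p.1; p.2].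
have -> : gsize e = #|f @: D|.
  rewrite /gsize; apply: eq_card => A.
  by apply/imsetP/imsetP => -[p pD ->]; exists p; rewrite // inE in pD *.
rewrite -[leqRHS]sum1_card (partition_big_imset f) /= mulnC -sum_nat_const.
apply: leq_sum => _ /imsetP [[x y]] xyD ->; rewrite inE /= in xyD.
have neq : (x, y) != (y, x).
  by apply: contraTneq xyD => -[-> _]; rewrite e_irr.
rewrite sum1dep_card.
have -> : 2 = #|[set (x, y); (y, x)]| by rewrite cards2 neq.
apply/subset_leq_card/subsetP => p /set2P [] ->; rewrite !inE /f /= ?eqxx ?xyD //.
by rewrite e_sym xyD setUC eqxx.
Qed.

(** Double counting: reversing pairs matches those from [S] to [T] with those from [T] to [S]. *)
Lemma sum_nbrs_in_sym (S T : {set V}) :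
  \sum_(v in S) #|nbrs_in e T v| = \sum_(v in T) #|nbrs_in e S v|.
Proof.
under eq_bigr => v _ do rewrite card_nbrs_in.
under [RHS]eq_bigr => v _ do rewrite card_nbrs_in.
rewrite exchange_big /=; apply: eq_bigr => u _; apply: eq_bigr => v _.
by rewrite e_sym.
Qed.

Lemma sum_le_max_degree (S : {set V}) (F : V -> nat) :
  (forall v, F v <= gdegree e v) -> \sum_(v in S) F v <= #|S| * max_degree e.
Proof.
move=> leF; rewrite -sum_nat_const; apply: leq_sum => v _.
exact: leq_trans (leF v) (gdegree_le_max v).
Qed.

Lemma alliance_card_ge (k : nat) (S : {set V}) : irreflexive e ->
    [forall v in ~: S, #|nbrs_in e S v| >= #|nbrs_in e (~: S) v| + k] ->
  2 * gsize e + k * gorder V <= (3 * max_degree e + k) * #|S|.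
Proof.
move=> e_irr /forall_inP allS; have := handshake_le e_irr.
rewrite (bigID (mem S)) /=.
have inS := @sum_le_max_degree S _ (fun v => leqnn _).
have cross : \sum_(v in ~: S) #|nbrs_in e S v| <= #|S| * max_degree e.
  rewrite sum_nbrs_in_sym; apply: sum_le_max_degree => v.
  by rewrite (gdegree_split S) leq_addl.
(* Adding |N_S(v)| to both sides of the alliance condition gives deg v + k <= 2 |N_S(v)|, which is
   then summed over the complement. *)
have outS : \sum_(v in ~: S) gdegree e v + k * #|~: S|
              <= 2 * \sum_(v in ~: S) #|nbrs_in e S v|.
  rewrite mulnC -sum_nat_const -big_split big_distrr /=; apply: leq_sum => v vS.
  by rewrite (gdegree_split S) mul2n -addnn -addnA leq_add2l allS.
rewrite [X in _ <= _ + X](eq_bigl (fun v => v \in ~: S)); last by move=> v; rewrite inE.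
rewrite /gorder -(cardsC S); nia.
Qed.

(** The minimum is spelled out so that k = 1 and k = 2 unfold to [goa_number] and [gsoa_number]. *)
Lemma alliance_number_ge (k : nat) : irreflexive e ->
  2 * gsize e + k * gorder V <= (3 * max_degree e + k) *
    #|[arg min_(S < [set: V] | (S != set0) &&
         [forall v in ~: S, #|nbrs_in e S v| >= #|nbrs_in e (~: S) v| + k]) #|S| ]|.
Proof.
(* On an empty vertex type no alliance exists, but the left side vanishes: n = 0, and the empty
   degree sum forces m = 0. *)
move=> e_irr; have [V0|] := posnP #|V|.
  have := handshake_le e_irr; rewrite /gorder V0 muln0 big_pred0 => [|v].
    by rewrite leqn0 addn0 => /eqP->.
  by case: (fintype0 v V0).
rewrite -cardsT card_gt0 => T_neq0.
case: arg_minnP => [|S /andP[_ allS] _]; last exact: alliance_card_ge.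
(* The default [[set: V]] is an alliance: no vertex lies outside it. *)
by rewrite T_neq0; apply/forall_inP => v; rewrite !inE.
Qed.

End OffensiveAlliance.

(** As [c] is an integer, bounding the ceiling by [c] amounts to bounding the quotient itself. *)
Lemma ceil_div_le (a b c : nat) : 0 < b -> a <= b * c ->
  (Num.ceil (a%:R / b%:R : rat) <= c%:Z)%R.
Proof.
move=> b_gt0 le_a_bc.
by rewrite Num.Theory.ceil_le_int Num.Theory.ler_pdivrMr ?Num.Theory.ltr0n //
           -pmulrn -GRing.natrM Num.Theory.ler_nat mulnC.
Qed.

Theorem theorem5 (V : finType) (e : rel V)
    (e_sym : symmetric e) (e_irr : irreflexive e)
    (n m Delta : nat)
    (order_n : gorder V = n) (size_m : gsize e = m)
    (max_degree_Delta : max_degree e = Delta) :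
  (Num.ceil ((2 * m + n)%N%:R / (3 * Delta + 1)%N%:R : rat)
     <= (goa_number e)%:Z)%R
  /\
  (Num.ceil ((2 * (m + n))%N%:R / (3 * Delta + 2)%N%:R : rat)
     <= (gsoa_number e)%:Z)%R.
Proof.
subst n m Delta; split; apply: ceil_div_le; rewrite ?addn_gt0 ?orbT //.
- by have := alliance_number_ge _ _ e_sym 1 e_irr; rewrite mul1n.
- by have := alliance_number_ge _ _ e_sym 2 e_irr; rewrite mulnDr.
Qed.
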